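(* Let $T$ be a contraction on a Hilbert space $\mathcal H$. Let $V$, acting on a Hilbert space $\mathcal K$, be an isometric dilation of $T$ corresponding to an isometry $\mathcal E:\mathcal H\to\mathcal K$, and let $V_m$, acting on a Hilbert space $\mathcal K_m$, be any minimal isometric dilation of $T$ corresponding to an isometry $\mathcal E_m:\mathcal H\to\mathcal K_m$. Then there exists a unique isometry $\Xi\in\mathcal B(\mathcal K_m,\mathcal K)$ such that $$\mathcal E=\Xi\,\mathcal E_m\quad\text{and}\quad \Xi V_m^*=V^*\Xi.$$
   Context: An isometry $V$ on $\mathcal K$ is an isometric dilation of a contraction $T$ on $\mathcal H$ corresponding to an isometry $\mathcal E:\mathcal H\to\mathcal K$ if $\mathcal ET^*=V^*\mathcal E$. It is minimal if $\mathcal K=\overline{\operatorname{span}}\{V^m(\mathcal E\mathcal H):m\ge0\}$. *)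

(* Defs.v *)
From HB Require Import structures.
From mathcomp Require Import all_boot all_order all_algebra complex.
From mathcomp Require Import all_classical all_reals all_analysis.

Set Implicit Arguments.
Unset Strict Implicit.
Unset Printing Implicit Defensive.

Import Order.TTheory GRing.Theory Num.Theory.
Import numFieldNormedType.Exports.

Local Open Scope classical_set_scope.
Local Open Scope ring_scope.

(* Complex Hilbert spaces: Banach spaces over R[i] whose norm comes from an
   inner product, linear in its first argument and conjugate-linear in its
   second one. *)
HB.mixin Record CompleteNormedModule_isHilbert (R : realType) H
    of CompleteNormedModule R[i] H := {
  inner : {dot H for (@Num.conj R[i])} ;
  inner_normE : forall x : H, inner x x = `|x| ^+ 2
}.

#[short(type="hilbertType")]
HB.structure Definition Hilbert (R : realType) :=
  {H of CompleteNormedModule R[i] H & CompleteNormedModule_isHilbert R H}.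

Section Operators.
Variables (R : realType) (H K : hilbertType R).

Definition contractive (A : {linear H -> K}) := forall x, `|A x| <= `|x|.

Definition isometric (A : {linear H -> K}) := forall x, `|A x| = `|x|.

(* [adjoint A y] is the vector representing the functional
   [fun x => inner (A x) y]; for bounded [A] it exists by the Riesz
   representation theorem and it is unique. The value 0 is only a default for
   unbounded [A]. *)
Definition adjoint (A : {linear H -> K}) (y : K) : H :=
  xget 0 [set z : H | forall x : H, inner (A x) y = inner x z].

Definition lin_span (S : set H) : set H :=
  [set x | exists (n : nat) (a : 'I_n -> R[i]) (s : 'I_n -> H),
    (forall i, S (s i)) /\ x = \sum_(i < n) a i *: s i].

End Operators.

Section Dilations.
Variables (R : realType) (H K : hilbertType R).

Definition isometric_dilation (T : {linear H -> H}) (V : {linear K -> K})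
    (E : {linear H -> K}) :=
  [/\ isometric V, isometric E &
      forall h : H, E (adjoint T h) = adjoint V (E h)].

Definition minimal_isometric_dilation (T : {linear H -> H})
    (V : {linear K -> K}) (E : {linear H -> K}) :=
  isometric_dilation T V E /\
  closure (lin_span (\bigcup_m [set iter m V k | k in range E])) = [set: K].

End Dilations.

(* Main.v *)
Require Import Defs.
From HB Require Import structures.
From mathcomp Require Import all_boot all_order all_algebra complex.
From mathcomp Require Import all_classical all_reals all_analysis.
From mathcomp Require Import ring.
Import Order.TTheory GRing.Theory Num.Theory.
Import numFieldNormedType.Exports.

(** The vectors [Vm^m (Em h)] span a dense subspace of [Km], so an isometry with
    [Xi (Vm^m (Em h)) = V^m (E h)] exists as soon as the inner products of these
    vectors agree with those of the vectors [V^m (E h)] ([gram_isometry]). They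
    agree because both are determined by [T] alone: isometries cancel the common
    powers, the remaining power moves to the other side as a power of the
    adjoint, and the dilation identity turns [V*^m (E h)] into [E (T*^m h)],
    where [A*] denotes the adjoint of [A], so that
      [<V^(l + m) (E h), V^l (E h')> = <h, T*^m h'>]
    ([isometric_dilation_gram]).

    The intertwining identity for [Xi] is then checked on the spanning vectors:
    an adjoint removes one factor [Vm] or [V] when [m > 0], and for [m = 0] it is
    the dilation identity. It extends by density, all maps being contractions
    ([contractive_ext]).

    For uniqueness, an isometry that intertwines the adjoints also intertwines
    the isometries themselves ([isometric_intertwiner_commutes]): the vector
    [Xi (Vm x)] has the same norm as its image [Xi x] under [V*], which forces
    it to lie in the range of [V]. Together with [E = Xi Em] this prescribes
    [Xi] on all the vectors [Vm^m (Em h)].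

    Adjoints are described by a default-valued choice, so the existence of the
    adjoint of an isometry has to be established ([adjoint_isometric_ex]): the
    vector [V* y] is the [z] for which [V z] is nearest to [y]. *)
Local Open Scope classical_set_scope.
Local Open Scope ring_scope.

(** * Inner products *)

Lemma innerC {R : realType} {H : hilbertType R} (x y : H) :
  inner x y = Num.conj (inner y x).
Proof. by rewrite hermC expr0 mul1r. Qed.

Lemma sqnormD {R : realType} {H : hilbertType R} (x y : H) :
  `|x + y| ^+ 2 = `|x| ^+ 2 + `|y| ^+ 2 + (inner x y + Num.conj (inner x y)).
Proof.
rewrite -!inner_normE linearDl !linearDr /= [inner y x]innerC.
by rewrite addrACA addrCA addrA addrC; ring.
Qed.

Lemma parallelogram {R : realType} {H : hilbertType R} (x y : H) :
  `|x + y| ^+ 2 + `|x - y| ^+ 2 = (`|x| ^+ 2 + `|y| ^+ 2) *+ 2.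
Proof. by rewrite !sqnormD normrN linearNr /= rmorphN; ring. Qed.

(** Polarization: the norm determines the real part of [<x, a y>] for each [a],
    and [a = 1] and [a = 'i] recover the inner product. *)
Lemma isometric_inner {R : realType} {H K : hilbertType R} (V : {linear H -> K}) :
  isometric V -> forall x y, inner (V x) (V y) = inner x y.
Proof.
move=> isoV x y.
have re a : inner (V x) (a *: V y) + Num.conj (inner (V x) (a *: V y)) =
          inner x (a *: y) + Num.conj (inner x (a *: y)).
  have /eqP : `|V x + a *: V y| ^+ 2 = `|x + a *: y| ^+ 2.
    by rewrite -linearZ -linearD isoV.
  by rewrite !sqnormD -linearZ !isoV => /eqP/addrI; rewrite linearZ.
have := re 1; have := re 'i; rewrite !scale1r !linearZr_LR /= !rmorphM /= conjCi.
move: (inner (V x) (V y)) (inner x y) => a b.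
have -> : Num.conj (- 'i : R[i]) = 'i by rewrite rmorphN /= conjCi opprK.
move: (Num.conj a) (Num.conj b) => a' b' hi h1.
have i2 : 'i * 'i = -1 :> R[i] by rewrite -expr2 sqrCi.
have E : 2 * a = 2 * b.
  have -> : 2 * a = (a + a') + 'i * (- 'i * a + 'i * a').
    by rewrite mulrDr !mulrA mulrN i2; ring.
  rewrite h1 hi mulrDr !mulrA mulrN i2; ring.
by apply: (mulfI _ E); rewrite pnatr_eq0.
Qed.

(** * Completeness and infima over the complex scalars *)

(** A form of Cantor's intersection theorem, for sets [P e] which need not be
    closed: [P e] holds the approximate solutions with tolerance [e] of a problem
    whose approximate solutions are close to each other. It serves both for the
    nearest point in the range of an isometry and for extension by density. *)
Lemma cauchy_family_limit {R : realType} {H : completeNormedModType R[i]}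
    (P : R[i] -> set H) :
  (forall e, 0 < e -> P e !=set0) ->
  (forall e e', 0 < e -> e <= e' -> P e `<=` P e') ->
  (forall e, 0 < e ->
    exists2 d, 0 < d & forall x y, P d x -> P d y -> `|x - y| < e) ->
  exists l, forall e, 0 < e -> exists2 x, P e x & `|l - x| < e.
Proof.
move=> P0 Pmono Pdiam.
pose F : set_system H := filter_from [set e | 0 < e] P.
have FF : ProperFilter F.
  apply: filter_from_proper => [|e]; last exact: P0.
  apply: filter_from_filter; first by exists 1 => /=.
  move=> e e' /= e0 e'0; have [le|/ltW le] := real_leP (gtr0_real e0) (gtr0_real e'0).
    by exists e => //= x Px; split=> //; apply: Pmono Px.
  by exists e' => //= x Px; split=> //; apply: Pmono Px.
have cF : cvg F.
  apply: cauchy_cvg; apply/cauchy_ballP => e /= e0.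
  have [d d0 dP] := Pdiam _ e0.
  exists (P d, P d) => //=; first by split; exists d.
  case=> x y /= [Px Py]; rewrite -ball_normE /ball_ /=; exact: dP.
exists (lim F) => e e0.
have : F (ball (lim F) e) by apply: cF; exact: nbhsx_ballx.
have : F (P e) by exists e.
move=> h1 h2; have [x [Px]] := filter_ex (filterI h1 h2).
by rewrite -ball_normE /ball_ /=; exists x.
Qed.

(** The order of [R[i]] is partial, so the infimum is taken over real parts. *)
Lemma ge0_inf {R : realType} {T : Type} (f : T -> R[i]) (t0 : T) :
  (forall t, 0 <= f t) ->
  exists d : R[i], [/\ 0 <= d, forall t, d <= f t &
    forall e, 0 < e -> exists t, f t < d + e].
Proof.
move=> f0; have fE t : (complex.Re (f t))%:C%C = f t by rewrite RRe_real // ger0_real.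
pose A := range (fun t => complex.Re (f t)).
have lb0 : lbound A 0 by move=> _ [t _ <-]; have := f0 t; rewrite -fE lecR.
have Ai : has_inf A by split; [exists (complex.Re (f t0)), t0|exists 0].
exists (inf A)%:C%C; split.
- by rewrite lecR; apply: lb_le_inf => //; case: Ai.
- by move=> t; rewrite -fE lecR; apply: (inf_lbound (proj2 Ai)); exists t.
- move=> e e0; have eE : (complex.Re e)%:C%C = e by rewrite RRe_real // gtr0_real.
  have : 0 < complex.Re e by rewrite -ltcR eE.
  move=> /inf_adherent /(_ Ai)[_ [t _ <-] lt].
  by exists t; rewrite -fE -eE -rmorphD /= ltcR.
Qed.

(** * The adjoint of an isometry *)

(** With [t = <p, w> / |w|^2], the squared distance [|p - t w|^2] equals
    [|p|^2 - |<p, w>|^2 / |w|^2]. *)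
Lemma nearest_orthogonal {R : realType} {H : hilbertType R} (p w : H) :
  (forall t : R[i], `|p| <= `|p - t *: w|) -> inner w p = 0.
Proof.
move=> min; have [->|w0] := eqVneq w 0; first exact: linear0l.
have n0 : 0 < `|w| ^+ 2 by rewrite exprn_gt0// normr_gt0.
have := min (inner p w / `|w| ^+ 2).
rewrite -ler_sqr ?nnegrE// sqnormD normrN normrZ linearNr linearZr_LR /=.
rewrite exprMn normrM normfV exprMn exprVn [`| _ ^+ 2 |]gtr0_norm//.
rewrite rmorphN /= !rmorphM /=.
rewrite [inner w p]innerC; move: (inner p w) (`|w| ^+ 2) n0 => c n n0.
have nV : Num.conj (n^-1 : R[i]) = n^-1 by rewrite conj_Creal// gtr0_real// invr_gt0.
rewrite !conjCK nV.
have -> : `|c| ^+ 2 / n ^+ 2 * n = `|c| ^+ 2 / n.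
  by field; rewrite gt_eqF.
have -> : Num.conj c / n * c = `|c| ^+ 2 / n by rewrite normCK; ring.
have -> : c / n * Num.conj c = `|c| ^+ 2 / n by rewrite normCK; ring.
rewrite addrA addrK lerDl oppr_ge0 pmulr_lle0 ?invr_gt0// => c2.
by apply/eqP; rewrite conjC_eq0 -normr_eq0 -sqrf_eq0 eq_le c2 exprn_ge0.
Qed.

(** Points nearly nearest to [y] in the range of [V] are close to each other by
    the parallelogram identity, and so are their preimages, [V] being isometric;
    hence a nearest point [V z] exists by completeness of [H]. Then
    [y - V z] is orthogonal to the range of [V], whence
    [<V x, y> = <V x, V z> = <x, z>]. *)
Lemma adjoint_isometric_ex {R : realType} {H K : hilbertType R}
    (V : {linear H -> K}) :
  isometric V -> forall y, exists z, forall x, inner (V x) y = inner x z.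
Proof.
move=> isoV y.
have [d [d0 dle dlt]] := @ge0_inf R H (fun z => `|y - V z|) 0 (fun z => normr_ge0 _).
have [||e e0|z zP] :=
  @cauchy_family_limit R H (fun e => [set z | `|y - V z| < d + e]).
- by move=> e /dlt.
- by move=> e e' _ le z /= /lt_le_trans; apply; rewrite lerD2l.
  (* The tolerance [r] is such that [4 (d + r)^2 - 4 d^2 = r (8 d + 4 r)] is less
     than [e^2]; it is at most 1 so that [4 r] can be replaced by 4. *)
- pose D := e ^+ 2 + (8 * d + 4).
  have D0 : 0 < D by rewrite ltr_wpDl ?exprn_ge0 ?ltW// ltr_wpDl// mulr_ge0.
  pose r := e ^+ 2 / D.
  have r0 : 0 < r by rewrite divr_gt0 ?exprn_gt0.
  have r1 : r <= 1 by rewrite ler_pdivrMr// mul1r lerDl addr_ge0// mulr_ge0.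
  have rD : r * (8 * d + 4) < e ^+ 2.
    by rewrite -[ltRHS](divfK (lt0r_neq0 D0)) ltr_pM2l// ltrDr exprn_gt0.
  exists r => // u v /= Pu Pv.
  have key : `|u - v| ^+ 2 + (2 * d) ^+ 2 <= ((d + r) ^+ 2 + (d + r) ^+ 2) *+ 2.
    have dr : 0 <= d + r by rewrite addr_ge0// ltW.
    apply: (@le_trans _ _ ((`|y - V u| ^+ 2 + `|y - V v| ^+ 2) *+ 2)).
      rewrite -parallelogram addrC lerD //.
        rewrite ler_sqr ?nnegrE ?mulr_ge0 //.
        have -> : y - V u + (y - V v) = 2 *: (y - V (2^-1 *: (u + v))).
          rewrite scalerBr -linearZ scalerA divff ?pnatr_eq0// scale1r linearD.
          by rewrite scaler_nat mulr2n opprD addrACA.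
        by rewrite normrZ ger0_norm// ler_wpM2l.
      have -> : y - V u - (y - V v) = V (v - u).
        by rewrite opprB addrC addrA subrK linearB.
      by rewrite isoV distrC.
    by rewrite lerMn2r /= lerD// ler_sqr ?nnegrE// ltW.
  have {}key : `|u - v| ^+ 2 <= r * (8 * d + 4 * r).
    move: key; rewrite -lerBrDr => /le_trans; apply.
    by rewrite le_eqVlt; apply/orP; left; apply/eqP; ring.
  rewrite -ltr_sqr ?nnegrE ?(ltW e0)//; apply: le_lt_trans key _.
  apply: le_lt_trans rD; apply: ler_wpM2l; first exact: ltW.
  by rewrite lerD2l -[leRHS]mulr1 ler_wpM2l.
have min w : `|y - V z| <= `|y - V z - V w|.
  rewrite -addrA -opprD -linearD; apply: le_trans (dle _).
  apply/ler_addgt0Pr => e e0.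
  have e20 : 0 < e / 2 by rewrite divr_gt0.
  have [u /= uP uz] := zP _ e20.
  rewrite -(subrK (V u) y) -addrA -linearB (le_trans (ler_normD _ _))// isoV.
  by rewrite [e]splitr addrA lerD ?ltW// distrC.
exists z => w; rewrite -(isometric_inner _ isoV).
apply/eqP; rewrite -subr_eq0 -linearB; apply/eqP.
apply: nearest_orthogonal => t; rewrite -linearZ; exact: min.
Qed.

Lemma adjoint_isometric {R : realType} {H K : hilbertType R}
    (V : {linear H -> K}) :
  isometric V -> forall x y, inner (V x) y = inner x (adjoint V y).
Proof.
move=> isoV x y; have [z zP] := adjoint_isometric_ex V isoV y.
by move: x; rewrite /adjoint; case: xgetP => [_ _ //|/(_ z)/(_ zP)].
Qed.

Lemma inner_right_inj {R : realType} {H : hilbertType R} (y z : H) :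
  (forall x, inner x y = inner x z) -> y = z.
Proof.
move=> yz; apply/eqP; rewrite -subr_eq0 -normr_eq0 -sqrf_eq0 -inner_normE.
by rewrite linearBr /= yz subrr.
Qed.

Lemma adjoint_linear {R : realType} {H K : hilbertType R} (V : {linear H -> K}) :
  isometric V -> linear (adjoint V).
Proof.
move=> isoV a y z; apply: inner_right_inj => x.
by rewrite linearPr /= -!adjoint_isometric// linearPr.
Qed.

Lemma adjointK {R : realType} {H K : hilbertType R} (V : {linear H -> K}) :
  isometric V -> cancel V (adjoint V).
Proof.
move=> isoV y; apply: inner_right_inj => x.
by rewrite -adjoint_isometric// isometric_inner.
Qed.

Lemma linear_funP {R : realType} {H K : hilbertType R} (f : H -> K) :
  linear f -> exists L : {linear H -> K}, L = f :> (H -> K).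
Proof.
move=> linf.
pose L : {linear H -> K} := HB.pack f (GRing.isLinear.Build R[i] H K _ f linf).
by exists L.
Qed.

(** Pythagoras, [V (adjoint V y)] being the projection of [y] onto the range of
    [V]. *)
Lemma sqnorm_sub_adjoint {R : realType} {H K : hilbertType R}
    (V : {linear H -> K}) (y : K) :
  isometric V -> `|y| ^+ 2 = `|adjoint V y| ^+ 2 + `|y - V (adjoint V y)| ^+ 2.
Proof.
move=> isoV; have := sqnormD (y - V (adjoint V y)) (V (adjoint V y)).
rewrite subrK => ->; rewrite isoV [X in _ + X = _](_ : _ = 0) ?addr0 1?addrC//.
rewrite innerC adjoint_isometric//.
have [A AE] := linear_funP _ (adjoint_linear V isoV).
by rewrite -AE linearB AE adjointK// subrr linear0r conjC0 conjC0 addr0.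
Qed.

Lemma adjoint_contraction {R : realType} {H K : hilbertType R}
    (V : {linear H -> K}) (y : K) :
  isometric V -> `|adjoint V y| <= `|y|.
Proof.
move=> isoV; rewrite -ler_sqr ?nnegrE// (sqnorm_sub_adjoint V y isoV).
by rewrite lerDl exprn_ge0.
Qed.

(** * Isometries defined on a dense span *)

Lemma dense_approx {R : realType} {H : hilbertType R} (S : set H) :
  closure S = setT -> forall x e, 0 < e -> exists2 u, S u & `|x - u| < e.
Proof.
move=> clS x e e0; have : closure S x by rewrite clS.
move=> /(_ (ball x e) (nbhsx_ballx _ _ e0))[u [Su]].
by rewrite -ball_normE /ball_ /=; exists u.
Qed.

Lemma contractive_ext {R : realType} {H K : hilbertType R}
    (f g : {linear H -> K}) (S : set H) :
  contractive f -> contractive g -> closure (lin_span S) = setT ->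
  (forall x, S x -> f x = g x) -> forall x, f x = g x.
Proof.
move=> cf cg dS fg x; apply/eqP; rewrite -subr_eq0 -normr_le0.
apply/ler_addgt0Pr => e e0; rewrite add0r.
have [_ [n [a [s [Ss ->]]]] us] := dense_approx _ dS x _ (divr_gt0 e0 (ltr0n _ 2)).
move: us; set u := \sum_(_ < _) _ => us.
have fgu : f u = g u.
  by rewrite !linear_sum; apply: eq_bigr => i _; rewrite !linearZ /= fg.
have -> : f x - g x = f (x - u) - g (x - u).
  by rewrite (linearB f) (linearB g) fgu opprB addrA subrK.
rewrite (le_trans (ler_normB _ _))// [e]splitr lerD//.
  exact: le_trans (cf _) (ltW us).
exact: le_trans (cg _) (ltW us).
Qed.

Section Extension.
Variables (R : realType) (H K : hilbertType R) (I : Type) (x : I -> H) (y : I -> K).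
Hypothesis gram : forall i j, inner (x i) (x j) = inner (y i) (y j).
Hypothesis dense : closure (lin_span (range x)) = setT.

(** The graph of the map sending [sum a_i x_i] to [sum a_i y_i]. It is kept as a
    relation since a vector may be a combination of the [x_i] in several ways;
    equality of the Gram matrices makes it isometric, hence single-valued. *)
Definition comb_graph (u : H) (v : K) : Prop :=
  exists s : seq (R[i] * I),
    u = \sum_(w <- s) w.1 *: x w.2 /\ v = \sum_(w <- s) w.1 *: y w.2.

Lemma comb_graph_linear a u v u' v' :
  comb_graph u v -> comb_graph u' v' -> comb_graph (a *: u + u') (a *: v + v').
Proof.
move=> [s [-> ->]] [s' [-> ->]].
exists ([seq (a * w.1, w.2) | w <- s] ++ s').
rewrite !big_cat !big_map !scaler_sumr /=.
by split; congr (_ + _); apply: eq_bigr => w _; rewrite scalerA.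
Qed.

Lemma comb_graph_norm u v : comb_graph u v -> `|u| = `|v|.
Proof.
move=> [s [-> ->]]; apply/eqP; rewrite -(@eqrXn2 _ 2)// -!inner_normE; apply/eqP.
rewrite !linear_sumlz; apply: eq_bigr => w _.
rewrite !linear_sumr; apply: eq_bigr => w' _.
by rewrite !linearZl_LR !linearZr_LR /= gram.
Qed.

Lemma comb_graph_dense z e : 0 < e -> exists u v, comb_graph u v /\ `|z - u| < e.
Proof.
move=> e0; have [_ [n [a [s [Ss ->]]]] us] := dense_approx _ dense z _ e0.
have xs i : exists j, x j = s i by have [j _ <-] := Ss i; exists j.
have [f fE] := choice xs.
exists (\sum_(i < n) a i *: s i), (\sum_(i < n) a i *: y (f i)); split=> //.
exists [seq (a i, f i) | i <- index_enum 'I_n]; rewrite !big_map /=.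
by split => //; apply: eq_bigr => i _; rewrite fE.
Qed.

(** The closure of this graph in [H * K], which is the graph of the extension. *)
Definition comb_closure (u : H) (v : K) : Prop :=
  forall e : R[i], 0 < e ->
    exists u' v', [/\ comb_graph u' v', `|u - u'| < e & `|v - v'| < e].

Lemma comb_closure_linear a u v u' v' : comb_closure u v -> comb_closure u' v' ->
  comb_closure (a *: u + u') (a *: v + v').
Proof.
move=> h h' e e0; have e2 : 0 < e / 2 by rewrite divr_gt0.
have a1 : 0 < `|a| + 1 by rewrite ltr_wpDl.
have [p [q [pq pu qv]]] := h _ (divr_gt0 e2 a1).
have [p' [q' [pq' pu' qv']]] := h' _ e2.
have est (L : hilbertType R) (b b' c c' : L) :
    `|b - c| < e / 2 / (`|a| + 1) -> `|b' - c'| < e / 2 ->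
    `|a *: b + b' - (a *: c + c')| < e.
  move=> bc bc'; rewrite opprD addrACA -scalerBr (le_lt_trans (ler_normD _ _))//.
  rewrite [e]splitr ler_ltD// normrZ -[leRHS](divfK (lt0r_neq0 a1)) mulrC.
  by apply: ler_pM => //; [exact: ltW|rewrite lerDl].
exists (a *: p + p'), (a *: q + q'); split; [exact: comb_graph_linear|exact: est..].
Qed.

Lemma comb_closure_norm u v : comb_closure u v -> `|u| = `|v|.
Proof.
move=> h; apply/eqP; rewrite eq_le; apply/andP; split; apply/ler_addgt0Pr => e e0.
all: have [p [q [/comb_graph_norm pq up vq]]] := h _ (divr_gt0 e0 (ltr0n _ 2)).
  rewrite -[u](subrK p) (le_trans (ler_normD _ _))// pq addrC.
  rewrite -[q](subrK v) [e]splitr addrA.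
  apply: lerD; last exact: ltW.
  rewrite (le_trans (ler_normD _ _))// addrC lerD// distrC; exact: ltW.
rewrite -[v](subrK q) (le_trans (ler_normD _ _))// -pq addrC.
rewrite -[p](subrK u) [e]splitr addrA.
apply: lerD; last exact: ltW.
rewrite (le_trans (ler_normD _ _))// addrC lerD// distrC; exact: ltW.
Qed.

(** The pair [(0, v - v')] is in the closed graph, so [|v - v'| = |0|]. *)
Lemma comb_closure_fun u v v' : comb_closure u v -> comb_closure u v' -> v = v'.
Proof.
move=> h h'; apply/eqP; rewrite -subr_eq0 -normr_eq0 addrC -scaleN1r.
rewrite -(comb_closure_norm _ _ (comb_closure_linear _ _ _ _ _ h' h)).
by rewrite scaleN1r addNr normr0.
Qed.

(** The images of two approximations of [u] are as close to each other as the
    approximations themselves, so that they converge in [K]. *)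
Lemma comb_closure_total u : exists v, comb_closure u v.
Proof.
have [|||v vP] := @cauchy_family_limit R K
    (fun e => [set v | exists u', comb_graph u' v /\ `|u - u'| < e]).
- by move=> e /(comb_graph_dense u)[u' [v [uv uu']]]; exists v, u'.
- move=> e e' _ le v [u' [? lt]]; exists u'; split=> //; exact: lt_le_trans le.
- move=> e e0; exists (e / 2); first by rewrite divr_gt0.
  move=> v v' [p [pv up]] [p' [pv' up']].
  rewrite addrC -scaleN1r -(comb_graph_norm _ _ (comb_graph_linear _ _ _ _ _ pv' pv)).
  have -> : -1 *: p' + p = (u - p') - (u - p).
    by rewrite scaleN1r opprB [LHS]addrC [RHS]addrC addrA subrK.
  by rewrite (le_lt_trans (ler_normB _ _))// [e]splitr ltrD.
exists v => e e0; have [v' [u' [uv' uu']] vv'] := vP e e0.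
by exists u', v'.
Qed.

(** Families with equal Gram matrices differ by an isometry. *)
Lemma gram_isometry :
  exists2 Xi : {linear H -> K}, isometric Xi & forall i, Xi (x i) = y i.
Proof.
have [f fP] := choice comb_closure_total.
have [|Xi XiE] := linear_funP f.
  move=> a u v; apply: comb_closure_fun (fP _) _; exact: comb_closure_linear.
exists Xi => [u|i]; rewrite XiE; first by rewrite -(comb_closure_norm _ _ (fP u)).
apply: comb_closure_fun (fP _) _ => e e0; exists (x i), (y i).
rewrite !subrr !normr0; split=> //; exists [:: (1, i)].
by rewrite !big_seq1 /= !scale1r.
Qed.
End Extension.

(** * Dilations *)

Lemma linear_funext {R : realType} {H K : hilbertType R} (f g : {linear H -> K}) :
  f =1 g -> f = g.
Proof.
case: f g => f [[f1] [f2]] [g [[g1] [g2]]] /= /funext fg.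
by subst g; do 4!f_equal; exact: Prop_irrelevance.
Qed.

Lemma isometric_dilation_adjoint_iter {R : realType} {H K : hilbertType R}
    {T : {linear H -> H}} {V : {linear K -> K}} {E : {linear H -> K}} :
  isometric_dilation T V E ->
  forall m h, iter m (adjoint V) (E h) = E (iter m (adjoint T) h).
Proof. by case=> _ _ ETV; elim=> [|m IH] h //=; rewrite IH ETV. Qed.

(** The right-hand side does not mention the dilation: all isometric dilations
    of [T] have the same inner products. *)
Lemma isometric_dilation_gram {R : realType} {H K : hilbertType R}
    {T : {linear H -> H}} {V : {linear K -> K}} {E : {linear H -> K}} :
  isometric_dilation T V E -> forall m l h h',
  inner (iter (l + m) V (E h)) (iter l V (E h')) = inner h (iter m (adjoint T) h').
Proof.
move=> dil m l h h'; have [isoV isoE _] := dil.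
rewrite -(isometric_inner E isoE) -(isometric_dilation_adjoint_iter dil).
elim: l => [|l IH]; last by rewrite addSn !iterS isometric_inner.
rewrite add0n; elim: m (E h') => [|m IH] //= k.
by rewrite adjoint_isometric// IH -iterSr.
Qed.

(** The vector [y = X (U x)] satisfies [V* y = X x], of the same norm as [y], so
    its distance to the range of [V] vanishes and [y = V V* y]. *)
Lemma isometric_intertwiner_commutes {R : realType} {H K : hilbertType R}
    (U : {linear H -> H}) (V : {linear K -> K}) (X : {linear H -> K}) :
  isometric U -> isometric V -> isometric X ->
  (forall x, X (adjoint U x) = adjoint V (X x)) -> forall x, X (U x) = V (X x).
Proof.
move=> isoU isoV isoX XUV x; apply/eqP.
have := sqnorm_sub_adjoint V (X (U x)) isoV.
rewrite -XUV adjointK// !isoX isoU -[LHS]addr0 => /addrI/esym/eqP.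
by rewrite sqrf_eq0 normr_eq0 subr_eq0.
Qed.

Theorem theorem4p1 (R : realType) (H K Km : hilbertType R)
  (T : {linear H -> H})
  (V : {linear K -> K}) (E : {linear H -> K})
  (Vm : {linear Km -> Km}) (Em : {linear H -> Km})
  (hT : contractive T)
  (hV : isometric_dilation T V E)
  (hVm : minimal_isometric_dilation T Vm Em) :
  exists! Xi : {linear Km -> K},
    [/\ isometric Xi,
        forall h : H, E h = Xi (Em h) &
        forall k : Km, Xi (adjoint Vm k) = adjoint V (Xi k)].
Proof.
have [isoV isoE ETV] := hV; have [dilVm dense] := hVm.
have [isoVm isoEm ETVm] := dilVm.
pose x (p : nat * H) := iter p.1 Vm (Em p.2).
pose y (p : nat * H) := iter p.1 V (E p.2).
have {}dense : closure (lin_span (range x)) = setT.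
  rewrite -dense; congr (closure (lin_span _)); apply/seteqP; split=> z.
    by move=> [[m h] _ <-]; exists m => //; exists (Em h) => //; exists h.
  by move=> [m _ [_ [h _ <-] <-]]; exists (m, h).
have gram p q : inner (x p) (x q) = inner (y p) (y q).
  move: p q => [k h] [l h'].
  (* The Gram formula has the larger power on the left. *)
  wlog lk : k l h h' / (l <= k)%N.
    have [lk|/ltnW kl] := leqP l k => W; first exact: W.
    by rewrite innerC W// -innerC.
  rewrite -(subnKC lk) /x /y /=.
  by rewrite (isometric_dilation_gram hV) (isometric_dilation_gram dilVm).
have [Xi isoXi Xixy] := gram_isometry _ _ _ _ _ _ gram dense.
have XiE m h : Xi (iter m Vm (Em h)) = iter m V (E h) := Xixy (m, h).
have isoC (L M : hilbertType R) (f : {linear L -> M}) : isometric f -> contractive f.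
  by move=> isof z; rewrite isof.
have [Am AmE] := linear_funP _ (adjoint_linear Vm isoVm).
have [A AE] := linear_funP _ (adjoint_linear V isoV).
exists Xi; split; first split=> //.
- by move=> h; exact: esym (XiE 0%N h).
- rewrite -AmE -AE; apply: (contractive_ext (Xi \o Am) (A \o Xi) (range x)) => //.
  + by move=> z /=; rewrite isoXi AmE adjoint_contraction.
  + by move=> z /=; rewrite AE (le_trans (adjoint_contraction _ _ isoV))// isoXi.
  + move=> _ [[[|m] h] _ <-] /=; rewrite AmE AE.
      by rewrite -ETVm [LHS](XiE 0%N) (XiE 0%N h) /= ETV.
    by rewrite (XiE m.+1) /= !adjointK// XiE.
move=> Xi' [isoXi' EXi' Xi'V]; apply: linear_funext.
apply: (contractive_ext _ _ (range x)) => //; [exact: isoC|exact: isoC|].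
move=> _ [[m h] _ <-]; rewrite Xixy /x /y /=.
elim: m => [|m IH] /=; first by rewrite EXi'.
by rewrite (isometric_intertwiner_commutes Vm V)// -IH.
Qed.
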